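(* Assume $\cos(\varphi_{GU})>0$. Then $$\cos(\varphi_{GU})\|\mathcal{G}c\|\le\|(\mathcal{U}^*\mathcal{U})^{\dagger/2}\mathcal{U}^*\mathcal{G}c\|\le\|\mathcal{G}c\|\quad\text{for all }c\in\ell^2(\mathbb{N}),$$ and $$\cos(\varphi_{GU})\,\kappa(\mathcal{G})\le\kappa\big((\mathcal{U}^*\mathcal{U})^{\dagger/2}\mathcal{U}^*\mathcal{G}\big)\le\frac{1}{\cos(\varphi_{GU})}\kappa(\mathcal{G}).$$
   Context: $H$ is a separable Hilbert space; $\{u_j\}$ and $\{g_k\}$ are frame sequences with closed spans $U$ and $G$, synthesis operators $\mathcal{U},\mathcal{G}:\ell^2(\mathbb{N})\to H$ and analysis operator $\mathcal{U}^*$. $(\mathcal{U}^*\mathcal{U})^{\dagger/2}$ is the positive square root of the Moore–Penrose pseudoinverse of $\mathcal{U}^*\mathcal{U}$. $\cos(\varphi_{GU}):=\inf_{g\in G,\|g\|=1}\|P_Ug\|$. For a nonzero bounded operator $T$ with closed range, the condition number is $\kappa(T):=\sup_{c\in\mathcal{N}(T)^\perp,\|c\|=1}\|Tc\|\,/\,\inf_{c\in\mathcal{N}(T)^\perp,\|c\|=1}\|Tc\|$. *)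

(* Defs.v *)
From mathcomp Require Import all_boot all_order all_algebra.
From mathcomp Require Import complex.
From mathcomp Require Import boolp classical_sets functions reals.
From Stdlib Require Import ClassicalEpsilon.
Import Order.TTheory GRing.Theory Num.Theory.

Set Implicit Arguments.
Unset Strict Implicit.
Unset Printing Implicit Defensive.

Local Open Scope ring_scope.
Local Open Scope classical_set_scope.

Section Defs.
Variable R : realType.
Local Notation C := R[i].

Definition cabs (z : C) : R := Num.sqrt (complex.Re z ^+ 2 + complex.Im z ^+ 2).

Definition cconv (s : nat -> C) (z : C) : Prop :=
  forall e : R, 0 < e -> exists N : nat, forall n : nat, (N <= n)%N -> cabs (s n - z) < e.

(* limit (chosen by Hilbert's epsilon; meaningful when the sequence converges) *)
Definition clim (s : nat -> C) : C := epsilon (inhabits 0) (cconv s).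

Definition seqC := nat -> C.

Definition l2 (c : seqC) : Prop :=
  exists M : R, forall n : nat, \sum_(k < n) cabs (c k) ^+ 2 <= M.

Definition l2normsq (c : seqC) : R :=
  sup [set x | exists n : nat, x = \sum_(k < n) cabs (c k) ^+ 2].

Definition l2norm (c : seqC) : R := Num.sqrt (l2normsq c).

Definition l2ip (c d : seqC) : C := clim (fun n => \sum_(k < n) c k * conjc (d k)).

(* bounded linear operators on l^2(N) (represented as maps on sequences,
   only their action on l^2 matters) *)
Definition l2_bounded_linear (T : seqC -> seqC) : Prop :=
  [/\ (forall c, l2 c -> l2 (T c)),
      (forall (a : C) c d, l2 c -> l2 d ->
        T (fun k => a * c k + d k) = (fun k => a * T c k + T d k))
    & (exists M : R, forall c, l2 c -> l2norm (T c) <= M * l2norm c)].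

Definition l2_selfadjoint (T : seqC -> seqC) : Prop :=
  forall c d, l2 c -> l2 d -> l2ip (T c) d = l2ip c (T d).

Definition l2_positive (T : seqC -> seqC) : Prop :=
  forall c, l2 c -> 0 <= l2ip (T c) c.

Definition is_pinv (T X : seqC -> seqC) : Prop :=
  [/\ l2_bounded_linear X,
      (forall c, l2 c -> T (X (T c)) = T c),
      (forall c, l2 c -> X (T (X c)) = X c),
      l2_selfadjoint (fun c => T (X c))
    & l2_selfadjoint (fun c => X (T c))].

Definition mp_pinv (T : seqC -> seqC) : seqC -> seqC :=
  epsilon (inhabits (fun c => c)) (is_pinv T).

Definition is_psqrt (T S : seqC -> seqC) : Prop :=
  [/\ l2_bounded_linear S, l2_selfadjoint S, l2_positive S
    & (forall c, l2 c -> S (S c) = T c)].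

Definition pos_sqrt (T : seqC -> seqC) : seqC -> seqC :=
  epsilon (inhabits (fun c => c)) (is_psqrt T).

Section Hilbert.
Variables (V : lmodType C) (ip : V -> V -> C).

Definition hnorm (x : V) : R := Num.sqrt (complex.Re (ip x x)).

Definition hconv (s : nat -> V) (x : V) : Prop :=
  forall e : R, 0 < e -> exists N : nat, forall n : nat, (N <= n)%N -> hnorm (s n - x) < e.

Definition hcauchy (s : nat -> V) : Prop :=
  forall e : R, 0 < e -> exists N : nat, forall n m : nat,
    (N <= n)%N -> (N <= m)%N -> hnorm (s n - s m) < e.

Definition inner_product : Prop :=
  [/\ (forall (a : C) x y z, ip (a *: x + y) z = a * ip x z + ip y z),
      (forall x y, ip y x = conjc (ip x y)),
      (forall x, 0 <= ip x x)
    & (forall x, ip x x = 0 -> x = 0)].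

Definition separable_hilbert_space : Prop :=
  [/\ inner_product,
      (forall s, hcauchy s -> exists x, hconv s x)
    & (exists d : nat -> V, forall x (e : R), 0 < e -> exists n, hnorm (x - d n) < e)].

Definition cspan (u : nat -> V) : set V :=
  [set x | forall e : R, 0 < e -> exists (n : nat) (a : nat -> C),
            hnorm (x - \sum_(k < n) a k *: u k) < e].

Definition synthesis (u : nat -> V) (c : seqC) : V :=
  epsilon (inhabits 0) (hconv (fun n => \sum_(k < n) c k *: u k)).

Definition analysis (u : nat -> V) (x : V) : seqC := fun j => ip x (u j).

Definition frame_sequence (u : nat -> V) : Prop :=
  exists A B : R, [/\ 0 < A, 0 < B & (forall f, cspan u f ->
    l2 (analysis u f) /\
    A * hnorm f ^+ 2 <= l2normsq (analysis u f) <= B * hnorm f ^+ 2)].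

Definition is_proj (S : set V) (x p : V) : Prop :=
  S p /\ forall y, S y -> ip (x - p) y = 0.

Definition proj (S : set V) (x : V) : V := epsilon (inhabits 0) (is_proj S x).

Definition cos_angle (G U : set V) : R :=
  inf [set r | exists g, [/\ G g, hnorm g = 1 & r = hnorm (proj U g)]].

End Hilbert.

Definition kappa (W : zmodType) (nrm : W -> R) (T : seqC -> W) : R :=
  let K := [set c | [/\ l2 c, l2norm c = 1 &
                      (forall d, l2 d -> T d = 0 -> l2ip c d = 0)]] in
  sup [set r | exists c, K c /\ r = nrm (T c)] /
  inf [set r | exists c, K c /\ r = nrm (T c)].

End Defs.

(* Main.v *)
(** Let [T0 = U U*] be the frame operator of [u] on [V] and [P] the orthogonal
    projection onto the closed span. The lower frame bound makes [T0]
    invertible on that span; with [J] its inverse composed with [P], the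
    pseudoinverse of the Gram operator [U* U] is [U* J J U], and
    [U* J Z U] with [Z = sqrt J] is its positive square root.
    Every self-adjoint square root [S] of the pseudoinverse satisfies
    [|S U* x| = |P x|], so both inequalities compare [|P_U g|] with [|g|] for
    [g] in the span of [g_k]. In particular [S U* G] and [G] have the same
    kernel, and the bound on condition numbers follows by taking suprema and
    infima over the same set of coefficient vectors. *)
Require Import Defs.
From mathcomp Require Import all_boot all_order all_algebra.
From mathcomp Require Import complex.
From mathcomp Require Import boolp classical_sets functions reals.
From mathcomp Require Import ring lra.
From Stdlib Require Import ClassicalEpsilon.
Import Order.TTheory GRing.Theory Num.Theory.
Local Open Scope ring_scope.

Set Implicit Arguments.
Unset Strict Implicit.
Unset Printing Implicit Defensive.

(** * Modulus and limits of complex numbers *)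

Section ComplexFacts.
Variable R : realType.
Implicit Types (a b z : R[i]) (s : nat -> R[i]).
Local Open Scope complex_scope.

Lemma ReD a b : complex.Re (a + b) = complex.Re a + complex.Re b.
Proof. by case: a; case: b. Qed.

Lemma ReN a : complex.Re (- a) = - complex.Re a.
Proof. by case: a. Qed.

Lemma ReJ a : complex.Re (conjc a) = complex.Re a.
Proof. by case: a. Qed.

Lemma conj_real (r : R) : conjc r%:C = r%:C.
Proof. by rewrite /conjc /= oppr0. Qed.

Lemma Re_rM (r : R) a : complex.Re (r%:C * a) = r * complex.Re a.
Proof. by case: a => x y /=; rewrite mul0r subr0. Qed.

Lemma sqr_cabs a : cabs a ^+ 2 = complex.Re a ^+ 2 + complex.Im a ^+ 2.
Proof. by rewrite sqr_sqrtr // addr_ge0 ?sqr_ge0. Qed.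

Lemma cabs_ge0 a : 0 <= cabs a.
Proof. exact: sqrtr_ge0. Qed.

Lemma cabs_real (r : R) : cabs r%:C = `|r|.
Proof. by rewrite /cabs /= expr0n addr0 sqrtr_sqr. Qed.

Lemma cabs_le_ReIm a : cabs a <= `|complex.Re a| + `|complex.Im a|.
Proof.
rewrite -(@ler_pXn2r _ 2) ?nnegrE ?addr_ge0 ?cabs_ge0 // sqr_cabs.
rewrite -(real_normK (num_real (complex.Re a))).
rewrite -(real_normK (num_real (complex.Im a))).
have := normr_ge0 (complex.Re a); have := normr_ge0 (complex.Im a); nra.
Qed.

Lemma sqr_cabs_mulJ a : (cabs a ^+ 2)%:C = a * conjc a.
Proof.
rewrite sqr_cabs; case: a => x y /=.
apply/eqP; rewrite eq_complex /=; apply/andP; split; apply/eqP; ring.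
Qed.

Lemma cabsJ a : cabs (conjc a) = cabs a.
Proof. by case: a => x y; rewrite /cabs /= sqrrN. Qed.

Lemma cabsN a : cabs (- a) = cabs a.
Proof. by case: a => x y; rewrite /cabs /= !sqrrN. Qed.

Lemma cabs_eq0 a : cabs a = 0 -> a = 0.
Proof.
move=> a0; have: cabs a ^+ 2 = 0 by rewrite a0 expr0n.
rewrite sqr_cabs => /eqP; rewrite paddr_eq0 ?sqr_ge0 // !sqrf_eq0.
by case: a {a0} => x y /= /andP[/eqP-> /eqP->].
Qed.

Lemma cabsD a b : cabs (a + b) <= cabs a + cabs b.
Proof.
rewrite -lecR rmorphD /=.
by move: (ler_normD a b); rewrite !normc_def.
Qed.

Lemma cconv_unique s a b : cconv s a -> cconv s b -> a = b.
Proof.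
move=> ca cb; apply/subr0_eq/cabs_eq0/eqP; rewrite eq_le cabs_ge0 andbT.
apply/ler_addgt0Pr => e e0; rewrite add0r.
have e2 : 0 < e / 2 by rewrite divr_gt0.
have [N1 h1] := ca _ e2; have [N2 h2] := cb _ e2.
have := h1 _ (leq_maxl N1 N2); have := h2 _ (leq_maxr N1 N2).
set t := s _ => lt2 lt1.
have -> : a - b = - (t - a) + (t - b) by ring.
by apply: (le_trans (cabsD _ _)); rewrite cabsN; lra.
Qed.

Lemma clim_eq s a : cconv s a -> clim s = a.
Proof.
move=> ca; apply: (@cconv_unique s) => //.
by apply: epsilon_spec; exists a.
Qed.

Lemma cconvJ s a : cconv s a -> cconv (fun n => conjc (s n)) (conjc a).
Proof.
move=> ca e /ca[N h]; exists N => n /h.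
by rewrite -rmorphB cabsJ.
Qed.

End ComplexFacts.

(** * Inner product spaces: Cauchy-Schwarz, norm and convergence *)

Section InnerProduct.
Variables (R : realType) (V : lmodType R[i]) (ip : V -> V -> R[i]).
Hypothesis ipP : inner_product ip.
Implicit Types (x y z : V) (s t : nat -> V).
Local Open Scope complex_scope.
Local Notation N := (hnorm ip).
Local Notation rip x y := (complex.Re (ip x y)).

Let ip_lin a x y z : ip (a *: x + y) z = a * ip x z + ip y z.
Proof. by case: ipP. Qed.

Lemma ipC x y : ip y x = conjc (ip x y).
Proof. by case: ipP. Qed.

Lemma ipDl x y z : ip (x + y) z = ip x z + ip y z.
Proof. by rewrite -{1}(scale1r x) ip_lin mul1r. Qed.

Lemma ip0l z : ip 0 z = 0.
Proof. by apply: (addrI (ip 0 z)); rewrite -ipDl !addr0. Qed.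

Lemma ipZl a x z : ip (a *: x) z = a * ip x z.
Proof. by rewrite -[a *: x]addr0 ip_lin ip0l addr0. Qed.

Lemma ipNl x z : ip (- x) z = - ip x z.
Proof. by rewrite -scaleN1r ipZl mulN1r. Qed.

Lemma ipBl x y z : ip (x - y) z = ip x z - ip y z.
Proof. by rewrite ipDl ipNl. Qed.

Lemma ipDr x y z : ip x (y + z) = ip x y + ip x z.
Proof. by rewrite ipC ipDl rmorphD /= -!ipC. Qed.

Lemma ipZr a x z : ip x (a *: z) = conjc a * ip x z.
Proof. by rewrite ipC ipZl rmorphM /= -ipC. Qed.

Lemma ipNr x z : ip x (- z) = - ip x z.
Proof. by rewrite ipC ipNl rmorphN /= -ipC. Qed.

Lemma ipBr x y z : ip x (y - z) = ip x y - ip x z.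
Proof. by rewrite ipDr ipNr. Qed.

Lemma ip_suml n (F : nat -> V) y :
  ip (\sum_(k < n) F k) y = \sum_(k < n) ip (F k) y.
Proof.
elim: n => [|n IH]; first by rewrite !big_ord0 ip0l.
by rewrite !big_ord_recr /= ipDl IH.
Qed.

Lemma rip_sym x y : rip x y = rip y x.
Proof. by rewrite ipC ReJ. Qed.

Lemma rip_ge0 x : 0 <= rip x x.
Proof. by have [_ _ /(_ x) + _] := ipP; rewrite lecE /= => /andP[]. Qed.

Lemma ip_self x : ip x x = (rip x x)%:C.
Proof.
have [_ _ /(_ x) + _] := ipP; rewrite lecE /=.
by case: (ip x x) => a b /= /andP[/eqP-> _].
Qed.

Lemma hnorm_sqr x : N x ^+ 2 = rip x x.
Proof. by rewrite sqr_sqrtr // rip_ge0. Qed.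

Lemma hnorm_ge0 x : 0 <= N x.
Proof. exact: sqrtr_ge0. Qed.

Lemma hnorm_eq0 x : N x = 0 -> x = 0.
Proof.
move=> x0; have [_ _ _] := ipP; apply.
by rewrite ip_self -hnorm_sqr x0 expr0n.
Qed.

Lemma hnorm0 : N 0 = 0.
Proof. by rewrite /hnorm ip0l sqrtr0. Qed.

Lemma hnormZ a x : N (a *: x) = cabs a * N x.
Proof.
apply/eqP; rewrite -(@eqrXn2 _ 2) ?mulr_ge0 ?cabs_ge0 ?hnorm_ge0 //.
rewrite exprMn !hnorm_sqr ipZl ipZr mulrA -sqr_cabs_mulJ Re_rM.
by [].
Qed.

Lemma hnorm_opp x : N (- x) = N x.
Proof. by rewrite /hnorm ipNl ipNr opprK. Qed.

Lemma hnorm_distC x y : N (x - y) = N (y - x).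
Proof. by rewrite -hnorm_opp opprB. Qed.

(** Kept general so as to cover both [Re <x, y>] and, for a positive operator [F], the possibly
    degenerate form [Re <F x, y>]. *)
Lemma posform_cauchy_schwarz (B : V -> V -> R) :
  (forall x y z, B (x + y) z = B x z + B y z) ->
  (forall (r : R) x z, B (r%:C *: x) z = r * B x z) ->
  (forall x y, B x y = B y x) -> (forall x, 0 <= B x x) ->
  forall x y, B x y ^+ 2 <= B x x * B y y.
Proof.
move=> BD BZ BC B0 x y.
have quad (r t : R) :
    0 <= r ^+ 2 * B x x + 2 * r * t * B x y + t ^+ 2 * B y y.
  have := B0 (r%:C *: x + t%:C *: y).
  rewrite !BD !BZ !(BC _ (_ + _)) !BD !BZ (BC y x).
  by congr (_ <= _); ring.
have [yy0|yy_neq0] := eqVneq (B y y) 0.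
  have [->|xy0] := eqVneq (B x y) 0; first by rewrite yy0 mulr0 expr0n.
  (* With [B y y = 0] the form is affine in [t], and this [t] gives it the value [-1]. *)
  have := quad 1 (- (B x x + 1) / (2 * B x y)).
  rewrite yy0 mulr0 addr0.
  have -> : 1 ^+ 2 * B x x + 2 * 1 * (- (B x x + 1) / (2 * B x y)) * B x y = -1.
    by field; exact: xy0.
  by rewrite ler0N1.
have yy_gt0 : 0 < B y y by rewrite lt_neqAle eq_sym yy_neq0 B0.
(* At [r = B y y] and [t = - B x y] the form equals [B y y * (B x x * B y y - B x y ^+ 2)]. *)
rewrite -subr_ge0 -(pmulr_rge0 _ yy_gt0).
have := quad (B y y) (- B x y); congr (_ <= _); ring.
Qed.

Lemma cauchy_schwarz x y : `|rip x y| <= N x * N y.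
Proof.
rewrite -(@ler_pXn2r _ 2) ?nnegrE ?mulr_ge0 ?hnorm_ge0 //.
rewrite exprMn !hnorm_sqr real_normK ?num_real //.
apply: (posform_cauchy_schwarz (B := fun x y => rip x y)).
- by move=> ? ? ?; rewrite ipDl ReD.
- by move=> ? ? ?; rewrite ipZl Re_rM.
- exact: rip_sym.
- exact: rip_ge0.
Qed.

Lemma le_hnormD x y : N (x + y) <= N x + N y.
Proof.
rewrite -(@ler_pXn2r _ 2) ?nnegrE ?addr_ge0 ?hnorm_ge0 // hnorm_sqr.
rewrite ipDl !ipDr !ReD (rip_sym y x) -!hnorm_sqr.
have := cauchy_schwarz x y; have := ler_norm (rip x y); nra.
Qed.

Lemma hnorm_tri y x z : N (x - z) <= N (x - y) + N (y - z).
Proof. by have := le_hnormD (x - y) (y - z); rewrite addrA subrK. Qed.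

Lemma parallelogram x y :
  N (x - y) ^+ 2 + N (x + y) ^+ 2 = 2 * N x ^+ 2 + 2 * N y ^+ 2.
Proof.
rewrite !hnorm_sqr !(ipDl, ipDr, ipNl, ipNr) !(ReD, ReN); ring.
Qed.

(** The factor 2 comes from applying the real Cauchy-Schwarz inequality separately to the real and
    imaginary parts; it is harmless for continuity of [ip]. *)
Lemma cabs_ip_le x y : cabs (ip x y) <= 2 * (N x * N y).
Proof.
apply: le_trans (cabs_le_ReIm _) _.
have -> : complex.Im (ip x y) = - rip ('i *: x) y.
  by rewrite ipZl; case: (ip x y) => a b /=; ring.
have := cauchy_schwarz x y; have := cauchy_schwarz ('i *: x) y.
rewrite normrN hnormZ.
have -> : cabs 'i = 1 :> R by rewrite /cabs /= expr0n expr1n add0r sqrtr1.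
rewrite mul1r; lra.
Qed.

Lemma le0_of_le_eps_mul (r b : R) : (forall e, 0 < e -> r <= e * b) -> r <= 0.
Proof.
move=> h; apply/ler_addgt0Pr => e e0; rewrite add0r.
have b1 : 0 < `|b| + 1 by rewrite ltr_wpDl.
have /h le := divr_gt0 e0 b1.
apply: (le_trans le); rewrite mulrAC ler_pdivrMr // ler_pM2l //.
by have := ler_norm b; lra.
Qed.

Lemma hconv_unique s x y : hconv ip s x -> hconv ip s y -> x = y.
Proof.
move=> sx sy; apply/subr0_eq/hnorm_eq0/eqP; rewrite eq_le hnorm_ge0 andbT.
apply: (le0_of_le_eps_mul (b := 2)) => e e0.
have [n1 h1] := sx _ e0; have [n2 h2] := sy _ e0.
have := h1 _ (leq_maxl n1 n2); have := h2 _ (leq_maxr n1 n2).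
have := hnorm_tri (s (maxn n1 n2)) x y.
rewrite (hnorm_distC x (s _)); lra.
Qed.

Lemma hconv_dominated s t x y (M : R) :
  (forall n, N (t n - y) <= M * N (s n - x)) -> hconv ip s x -> hconv ip t y.
Proof.
(* The divisor is positive whatever the sign of [M]. *)
move=> h sx e e0; have M1 : 0 < `|M| + 1 by rewrite ltr_wpDl.
have [n0 hn0] := sx _ (divr_gt0 e0 M1); exists n0 => n /hn0.
rewrite ltr_pdivlMr // mulrC; apply: le_lt_trans.
apply: (le_trans (h n)); apply: ler_wpM2r; first exact: hnorm_ge0.
by have := ler_norm M; lra.
Qed.

Lemma hconvD s t x y : hconv ip s x -> hconv ip t y ->
  hconv ip (fun n => s n + t n) (x + y).
Proof.
move=> sx ty e e0; have e2 : 0 < e / 2 by rewrite divr_gt0.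
have [n1 h1] := sx _ e2; have [n2 h2] := ty _ e2.
exists (maxn n1 n2) => n; rewrite geq_max => /andP[/h1 + /h2].
have -> : s n + t n - (x + y) = (s n - x) + (t n - y) by rewrite opprD addrACA.
have := le_hnormD (s n - x) (t n - y); lra.
Qed.

Lemma hconvZ a s x : hconv ip s x -> hconv ip (fun n => a *: s n) (a *: x).
Proof.
by apply: hconv_dominated => n; rewrite -scalerBr hnormZ.
Qed.

Lemma hconv_cst x : hconv ip (fun=> x) x.
Proof. by move=> e e0; exists 0%N => n _; rewrite subrr hnorm0. Qed.

Lemma hconv_shift s x : hconv ip s x -> hconv ip (fun n => s n.+1) x.
Proof. by move=> sx e /sx[n0 h]; exists n0 => n ln; apply/h/leqW. Qed.

Lemma hconv_cauchy s x : hconv ip s x -> hcauchy ip s.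
Proof.
move=> sx e e0; have e2 : 0 < e / 2 by rewrite divr_gt0.
have [n0 h] := sx _ e2; exists n0 => n m /h h1 /h h2.
have := hnorm_tri x (s n) (s m); rewrite (hnorm_distC x); lra.
Qed.

Lemma hnorm_lim_le s x (b : R) :
  hconv ip s x -> (forall n, N (s n) <= b) -> N x <= b.
Proof.
move=> sx h; apply/ler_addgt0Pr => e /sx[n0 /(_ _ (leqnn _))].
have := le_hnormD (x - s n0) (s n0); rewrite subrK hnorm_distC.
have := h n0; lra.
Qed.

Lemma cconv_ipl s x y :
  hconv ip s x -> cconv (fun n => ip (s n) y) (ip x y).
Proof.
move=> sx e e0; have M1 : 0 < 2 * (N y + 1).
  by rewrite mulr_gt0 // ltr_wpDl ?hnorm_ge0.
have [n0 h] := sx _ (divr_gt0 e0 M1); exists n0 => n /h.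
rewrite -ipBl ltr_pdivlMr //; apply: le_lt_trans.
apply: le_trans (cabs_ip_le _ _) _.
by have := hnorm_ge0 (s n - x); nra.
Qed.

Lemma cconv_ipr s x y :
  hconv ip s x -> cconv (fun n => ip y (s n)) (ip y x).
Proof.
move=> /(cconv_ipl y)/cconvJ; rewrite -ipC.
rewrite (_ : (fun n => _) = fun n => ip y (s n)) //.
by apply/funext => n; rewrite -ipC.
Qed.

(** * Orthogonal projection onto a closed subspace *)

Section Projection.
Hypothesis complete : forall s, hcauchy ip s -> exists x, hconv ip s x.
Variable S : set V.
Hypothesis S0 : S 0.
Hypothesis S_lin : forall a x y, S x -> S y -> S (a *: x + y).
Hypothesis S_closed : forall s x, (forall n, S (s n)) -> hconv ip s x -> S x.

Lemma subspaceB x y : S x -> S y -> S (x - y).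
Proof. by move=> Sx Sy; rewrite addrC -scaleN1r; apply: S_lin. Qed.

(** A minimizing sequence is Cauchy by the parallelogram law: midpoints of its terms stay in [S],
    hence at distance at least [d] from [x]. *)
Lemma exists_closest x :
  exists2 p, S p & forall y, S y -> N (x - p) <= N (x - y).
Proof.
pose D := [set r : R | exists2 y, S y & r = N (x - y)]%classic.
have Dne : nonempty D by exists (N (x - 0)); exists 0.
have Dlb : has_lbound D by exists 0 => _ [y _ ->]; exact: hnorm_ge0.
set d := inf D.
have dle y : S y -> d <= N (x - y) by move=> Sy; apply: (ge_inf Dlb); exists y.
have d0 : 0 <= d by apply: lb_le_inf => // _ [y _ ->]; exact: hnorm_ge0.
have step (e : R) : 0 < e -> exists2 y, S y & N (x - y) < d + e.
  by move=> e0; have [_ [y Sy ->] lt] := inf_adherent e0 (conj Dne Dlb); exists y.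
have inv0 n : 0 < n.+1%:R^-1 :> R by rewrite invr_gt0 ltr0n.
have /choice[s sP] n : exists y, S y /\ N (x - y) < d + n.+1%:R^-1.
  by have [y Sy lt] := step _ (inv0 n); exists y.
have invle n m : (n <= m)%N -> m.+1%:R^-1 <= n.+1%:R^-1 :> R.
  by move=> nm; rewrite lef_pV2 ?posrE ?ltr0n // ler_nat.
have invsmall (e : R) : 0 < e -> exists n, n.+1%:R^-1 < e.
  move=> e0; exists (Num.bound e^-1).
  rewrite -ltf_pV2 ?posrE ?invr_gt0 ?ltr0n // invrK.
  apply: lt_trans (archi_boundP _) _; first by rewrite invr_ge0 ltW.
  by rewrite ltr_nat.
(* With [q = 1/(k+1)], both distances are at most [d + q] and that of the midpoint is at least [d],
   so the squared gap is at most [4 (d + q)^2 - 4 d^2 = 8 d q + 4 q^2], and [q <= 1]. *)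
have close n m k : (k <= n)%N -> (k <= m)%N ->
    N (s n - s m) ^+ 2 <= k.+1%:R^-1 * (8 * d + 4).
  move=> /invle kn /invle km; have [Sn ltn] := sP n; have [Sm ltm] := sP m.
  have := parallelogram (x - s m) (x - s n).
  have -> : x - s m - (x - s n) = s n - s m by rewrite opprB addrC subrKA.
  have -> : x - s m + (x - s n) = 2%:C *: (x - 2^-1%:C *: (s n + s m)).
    rewrite scalerBr scalerA -rmorphM /= divff ?pnatr_eq0 // scale1r.
    rewrite rmorph_nat scaler_nat mulr2n addrACA; congr (_ + _).
    by rewrite -opprD addrC.
  rewrite hnormZ exprMn cabs_real ger0_norm //.
  have Smid : S (2^-1%:C *: (s n + s m)).
    by rewrite scalerDr; apply: S_lin => //; rewrite -[_ *: _]addr0; apply: S_lin.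
  have := dle _ Smid.
  have := hnorm_ge0 (x - s n); have := hnorm_ge0 (x - s m).
  have := inv0 k; have k1 : k.+1%:R^-1 <= 1 :> R by rewrite invf_le1 ?ltr0n // ler1n.
  move: k1 kn km ltn ltm d0.
  move: (N (x - s n)) (N (x - s m)) (N (x - _ *: _)) (N (s n - s m)) => b c a X.
  move: (k.+1%:R^-1) (n.+1%:R^-1) (m.+1%:R^-1) => q q1 q2.
  move=> q_le1 q1q q2q bq cq d0 q0 c0 b0 da E.
  have hb : b ^+ 2 <= (d + q) ^+ 2 by rewrite ler_pXn2r ?nnegrE //; lra.
  have hc : c ^+ 2 <= (d + q) ^+ 2 by rewrite ler_pXn2r ?nnegrE //; lra.
  have ha : d ^+ 2 <= a ^+ 2 by rewrite ler_pXn2r ?nnegrE //; lra.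
  nra.
have [|p sp] := complete (s := s).
  move=> e e0; have d8 : 0 < 8 * d + 4 by lra.
  have [k hk] := invsmall (e ^+ 2 / (8 * d + 4)) (divr_gt0 (exprn_gt0 2 e0) d8).
  exists k => n m kn km; rewrite -(@ltr_pXn2r _ 2) ?nnegrE ?hnorm_ge0 ?(ltW e0) //.
  by apply: le_lt_trans (close _ _ _ kn km) _; rewrite -ltr_pdivlMr.
exists p; first by apply: S_closed sp => n; case: (sP n).
move=> y /dle; apply: le_trans; apply/ler_addgt0Pr => e e0.
have e2 : 0 < e / 2 by rewrite divr_gt0.
have [n1 h1] := sp _ e2; have [n2 h2] := invsmall _ e2.
have := h1 _ (leq_maxl n1 n2); have := invle _ _ (leq_maxr n1 n2).
have [_] := sP (maxn n1 n2); have := hnorm_tri (s (maxn n1 n2)) x p.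
move: h2; move: (n2.+1%:R^-1) ((maxn n1 n2).+1%:R^-1) => q1 q2; lra.
Qed.

Lemma exists_proj x : exists p, is_proj ip S x p.
Proof.
have [p Sp pmin] := exists_closest x; exists p; split=> //.
have wmin (t : R) z : S z -> N (x - p) <= N ((x - p) - t%:C *: z).
  move=> Sz; have := pmin (t%:C *: z + p) (S_lin _ Sz Sp).
  by rewrite opprD addrCA addrC.
move: (x - p) wmin => w wmin y Sy.
have rip0 z : S z -> rip w z = 0.
  move=> Sz; apply/eqP; apply: contraT => nz.
  have zz0 := rip_ge0 z.
  (* Moving by [t] along [z] changes the squared distance by [- t^2 (|z|^2 + 2)], which contradicts
     minimality unless [t = 0]. The [+ 1] keeps the denominator positive. *)
  pose t : R := rip w z / (rip z z + 1).
  have := wmin t _ Sz.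
  rewrite -(@ler_pXn2r _ 2) ?nnegrE ?hnorm_ge0 // !hnorm_sqr.
  rewrite ipBl !ipBr !ipZl !ipZr !conj_real !(ReD, ReN, Re_rM) (rip_sym z w).
  have tE : rip w z = t * (rip z z + 1) by rewrite divfK // gt_eqF //; lra.
  have t0 : 0 < t ^+ 2.
    by rewrite exprn_even_gt0 //=; apply: contraNneq nz => t0; rewrite tE t0 mul0r.
  rewrite tE; nra.
(* Real orthogonality to ['i *: y] kills the imaginary part of [ip w y]. *)
have iy : S ('i *: y) by rewrite -[_ *: _]addr0; apply: S_lin.
have := rip0 _ Sy; have := rip0 _ iy; rewrite ipZr.
by case: (ip _ _) => a b /=; rewrite mul0r add0r mulN1r opprK => -> ->.
Qed.

Lemma projP x : is_proj ip S x (proj ip S x).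
Proof. by apply: epsilon_spec; exact: exists_proj. Qed.

Lemma proj_in x : S (proj ip S x).
Proof. by case: (projP x). Qed.

Lemma ip_projl x y : S y -> ip (proj ip S x) y = ip x y.
Proof.
by move=> Sy; have [_ /(_ _ Sy)/eqP] := projP x; rewrite ipBl subr_eq0 => /eqP.
Qed.

(** The difference of two projections of [x] lies in [S] and is orthogonal to [S], hence to
    itself. *)
Lemma proj_eq x p : is_proj ip S x p -> proj ip S x = p.
Proof.
move=> [Sp hp]; apply/subr0_eq/hnorm_eq0; rewrite /hnorm.
have Sd : S (proj ip S x - p) by apply: subspaceB => //; exact: proj_in.
have := hp _ Sd; have [_ /(_ _ Sd)] := projP x.
rewrite !ipBl => /eqP; rewrite subr_eq0 => /eqP-> /eqP.
by rewrite subr_eq0 => /eqP->; rewrite subrr sqrtr0.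
Qed.

Lemma proj_id x : S x -> proj ip S x = x.
Proof. by move=> Sx; apply: proj_eq; split=> // y _; rewrite subrr ip0l. Qed.

Lemma proj_linear a x y :
  proj ip S (a *: x + y) = a *: proj ip S x + proj ip S y.
Proof.
apply: proj_eq; split=> [|z Sz]; first by apply: S_lin; exact: proj_in.
by rewrite ipBl !ipDl !ipZl !ip_projl // subrr.
Qed.

Lemma hnorm_proj_le x : N (proj ip S x) <= N x.
Proof.
have := cauchy_schwarz x (proj ip S x); rewrite -(ip_projl x (proj_in x)) -hnorm_sqr.
rewrite ger0_norm ?sqr_ge0 // expr2.
have [->|p0] := eqVneq (N (proj ip S x)) 0; first by rewrite hnorm_ge0.
by rewrite ler_pM2r // lt_neqAle eq_sym p0 hnorm_ge0.
Qed.

End Projection.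
End InnerProduct.

(** * Positive square root of a bounded positive operator *)

Section SquareRoot.
Variables (R : realType) (V : lmodType R[i]) (ip : V -> V -> R[i]).
Hypothesis ipP : inner_product ip.
Hypothesis complete : forall s, hcauchy ip s -> exists x, hconv ip s x.
Implicit Types (x y z : V) (F L : V -> V).
Local Open Scope complex_scope.
Local Notation N := (hnorm ip).
Local Notation rip x y := (complex.Re (ip x y)).

Definition selfadjoint F := forall x y, ip (F x) y = ip x (F y).

Lemma linfunD F : linear F -> forall x y, F (x + y) = F x + F y.
Proof. by move=> linF x y; have := linF 1 x y; rewrite !scale1r. Qed.

Lemma linfun0 F : linear F -> F 0 = 0.
Proof. by move=> linF; apply: (addrI (F 0)); rewrite -(linfunD linF) !addr0. Qed.

Lemma linfunZ F : linear F -> forall a x, F (a *: x) = a *: F x.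
Proof.
by move=> linF a x; have := linF a x 0; rewrite (linfun0 linF) !addr0.
Qed.

Lemma linfunB F : linear F -> forall x y, F (x - y) = F x - F y.
Proof.
by move=> linF x y; rewrite (linfunD linF) -scaleN1r (linfunZ linF) scaleN1r.
Qed.

Section Iteration.
Variable Q : V -> V.
Hypothesis linQ : linear Q.
Hypothesis saQ : selfadjoint Q.
Hypothesis Q_le1 : forall x, N (Q x) <= N x.

(* A fixed point [Y = (Q + Y^2) / 2] satisfies [(1 - Y)^2 = 1 - Q]. *)
Fixpoint sqiter n x : V :=
  if n is m.+1 then 2^-1%:C *: (Q x + sqiter m (sqiter m x)) else 0.

(* The same recursion on scalars majorizes both [sqiter n] and the increments
   [sqiter n.+1 - sqiter n], so its convergence forces that of [sqiter]. *)
Fixpoint sqbound n : R :=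
  if n is m.+1 then 2^-1 * (1 + sqbound m ^+ 2) else 0.

Lemma sqiter_linear n : linear (sqiter n).
Proof.
elim: n => [|n IH] a x y /=; first by rewrite scaler0 addr0.
by rewrite linQ !IH addrACA -scalerDr [LHS]scalerDr !scalerA (mulrC a).
Qed.

Lemma sqiter_selfadjoint n : selfadjoint (sqiter n).
Proof.
elim: n => [|n IH] x y /=; first by rewrite ip0l // (ipC ipP) ip0l // conjc0.
by rewrite ipZl // ipZr // conj_real ipDl // ipDr // saQ !IH.
Qed.

(** Each iterate is a polynomial in [Q]. Taking for [L] first [Q], then another iterate, shows that
    the iterates commute. *)
Lemma sqiter_comm n L : linear L -> (forall x, L (Q x) = Q (L x)) ->
  forall x, L (sqiter n x) = sqiter n (L x).
Proof.
move=> linL LQ; elim: n => [|n IH] x /=; first exact: linfun0.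
by rewrite (linfunZ linL) (linfunD linL) LQ !IH.
Qed.

Lemma sqiterC n m x : sqiter n (sqiter m x) = sqiter m (sqiter n x).
Proof.
apply: sqiter_comm; first exact: sqiter_linear.
by move=> y; rewrite -sqiter_comm.
Qed.

Lemma sqbound_01 n : 0 <= sqbound n <= 1.
Proof. by elim: n => [|n IH] /=; [lra | nra]. Qed.

Lemma sqbound_leS n : sqbound n <= sqbound n.+1.
Proof.
elim: n => [|n IH] /=; first lra.
have := sqbound_01 n; have := sqbound_01 n.+1; move: IH => /=; nra.
Qed.

Lemma sqiter_le n x : N (sqiter n x) <= sqbound n * N x.
Proof.
elim: n x => [|n IH] x /=; first by rewrite hnorm0 // mul0r.
rewrite hnormZ // cabs_real ger0_norm ?invr_ge0 //.
have := le_hnormD ipP (Q x) (sqiter n (sqiter n x)).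
have := IH x; have := IH (sqiter n x); have := Q_le1 x.
have := sqbound_01 n; nra.
Qed.

(** Commuting iterates give [Y_(n+2) - Y_(n+1) = (Y_(n+1) + Y_n)(Y_(n+1) - Y_n) / 2]. The scalar
    sequence factors in the same way, so the majorization propagates by induction. *)
Lemma sqiter_incr_le n x :
  N (sqiter n.+1 x - sqiter n x) <= (sqbound n.+1 - sqbound n) * N x.
Proof.
elim: n x => [|n IH] x.
  rewrite /= !subr0 addr0 hnormZ // cabs_real ger0_norm ?invr_ge0 //.
  have := Q_le1 x; lra.
have -> : sqiter n.+2 x - sqiter n.+1 x =
    2^-1%:C *: (sqiter n.+1 (sqiter n.+1 x - sqiter n x)
                + sqiter n (sqiter n.+1 x - sqiter n x)).
  rewrite !(linfunB (@sqiter_linear _)) (sqiterC n n.+1) addrA subrK.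
  rewrite [sqiter n.+2 x]/= -[in LHS]/(sqiter n.+1 x) -/(sqiter n.+1).
  rewrite {4}/sqiter -/sqiter -scalerBr.
  by rewrite opprD addrACA subrr add0r.
rewrite hnormZ // cabs_real ger0_norm ?invr_ge0 //.
set w := sqiter n.+1 x - sqiter n x.
have := le_hnormD ipP (sqiter n.+1 w) (sqiter n w).
have := sqiter_le n.+1 w; have := sqiter_le n w; have := IH x.
rewrite -/w [sqbound n.+2]/=.
have := sqbound_01 n; have := sqbound_01 n.+1; have := sqbound_leS n.
have -> : sqbound n.+1 = 2^-1 * (1 + sqbound n ^+ 2) by [].
move: (sqiter n.+1 w) (sqiter n w) => w1 w2.
have := hnorm_ge0 ip x; have := hnorm_ge0 ip w.
set b := sqbound n; set c := 2^-1 * (1 + b ^+ 2).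
move=> w0 x0 bc c01 b01 wle w2le w1le wsum.
have h1 : (c + b) * N w <= (c + b) * ((c - b) * N x).
  by apply: ler_wpM2l => //; lra.
have -> : 2^-1 * (1 + c ^+ 2) - c = 2^-1 * ((c + b) * (c - b)) by rewrite /c; field.
lra.
Qed.

Lemma sqiter_dist_le n m x : (n <= m)%N ->
  N (sqiter m x - sqiter n x) <= (sqbound m - sqbound n) * N x.
Proof.
elim: m => [|m IH]; first by rewrite leqn0 => /eqP->; rewrite !subrr mul0r hnorm0.
rewrite leq_eqVlt => /orP[/eqP->|/IH le]; first by rewrite !subrr mul0r hnorm0.
apply: le_trans (hnorm_tri ipP (sqiter m x) _ _) _.
have := sqiter_incr_le m x; move: (sqbound m.+1) => b; lra.
Qed.

Lemma sqbound_cauchy (e : R) : 0 < e ->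
  exists n0, forall n, (n0 <= n)%N -> sqbound n - sqbound n0 < e.
Proof.
move=> e0; pose E := [set r : R | exists n, r = sqbound n]%classic.
have Eub : has_ubound E by exists 1 => _ [n ->]; case/andP: (sqbound_01 n).
have Ene : nonempty E by exists (sqbound 0); exists 0%N.
have [_ [n0 ->] lt] := sup_adherent e0 (conj Ene Eub).
exists n0 => n _; have : sqbound n <= sup E by apply: (ub_le_sup Eub); exists n.
lra.
Qed.

Lemma sqiter_cauchy x : hcauchy ip (sqiter^~ x).
Proof.
move=> e e0; have x1 : 0 < 2 * (N x + 1) by have := hnorm_ge0 ip x; lra.
have [n0 h] := sqbound_cauchy (divr_gt0 e0 x1); exists n0.
have near n : (n0 <= n)%N -> N (sqiter n x - sqiter n0 x) < e / 2.
  move=> ln; apply: le_lt_trans (sqiter_dist_le x ln) _.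
  have := h _ ln; rewrite ltr_pdivlMr //.
  have dge0 : 0 <= sqbound n - sqbound n0.
    elim: n ln => [|n IH]; first by rewrite leqn0 => /eqP->; rewrite subrr.
    rewrite leq_eqVlt => /orP[/eqP->|/IH]; first by rewrite subrr.
    have := sqbound_leS n; lra.
  nra.
move=> n m /near hn /near hm.
have := hnorm_tri ipP (sqiter n0 x) (sqiter n x) (sqiter m x).
rewrite (hnorm_distC ipP (sqiter n0 x)); lra.
Qed.

Lemma contraction_sqrt : exists Y : V -> V,
  [/\ linear Y, selfadjoint Y, forall x, N (Y x) <= N x
    & forall x, Y x = 2^-1%:C *: (Q x + Y (Y x))].
Proof.
have /choice[Y Yx] x := complete (sqiter_cauchy x).
have Yle x : N (Y x) <= N x.
  apply: (hnorm_lim_le ipP (Yx x)) => n; have := sqiter_le n x.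
  have := sqbound_01 n; have := hnorm_ge0 ip x; nra.
exists Y; split=> //.
- move=> a x y; apply: (hconv_unique ipP (Yx _)).
  have := hconvD ipP (hconvZ ipP a (Yx x)) (Yx y).
  congr (hconv ip); apply/funext => n; exact/esym/sqiter_linear.
- move=> x y; apply: cconv_unique (cconv_ipl ipP y (Yx x)) _.
  rewrite (_ : (fun n => _) = (fun n => ip x (sqiter n y))); last first.
    by apply/funext => n; exact: sqiter_selfadjoint.
  exact: cconv_ipr.
- move=> x; apply: (hconv_unique ipP (hconv_shift (Yx x))).
  apply: (hconvZ ipP); apply: (hconvD ipP) (hconv_cst ipP _) _.
  move=> e e0; have e2 : 0 < e / 2 by rewrite divr_gt0.
  have [n1 h1] := Yx x _ e2; have [n2 h2] := Yx (Y x) _ e2.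
  exists (maxn n1 n2) => n; rewrite geq_max => /andP[/h1 l1 /h2 l2].
  (* The error of [Y_n (Y_n x)] splits as [Y_n (Y_n x - Y x)], small because [Y_n] is a contraction,
     plus [Y_n (Y x) - Y (Y x)]. *)
  apply: le_lt_trans (hnorm_tri ipP (sqiter n (Y x)) _ _) _.
  rewrite -(linfunB (@sqiter_linear n)).
  have := sqiter_le n (sqiter n x - Y x); have := sqbound_01 n.
  have := hnorm_ge0 ip (sqiter n x - Y x); nra.
Qed.

End Iteration.

(** Cauchy-Schwarz for the form of [F], applied to [x] and [F x], gives [|F x|^4 <= <F x, x> <F (F
    x), F x> <= |x|^2 |F x|^2]. *)
Lemma hnorm_le_of_form_le F : linear F -> selfadjoint F ->
  (forall x, 0 <= rip (F x) x) -> (forall x, rip (F x) x <= rip x x) ->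
  forall x, N (F x) <= N x.
Proof.
move=> linF saF F0 F1 x.
have cs : rip (F x) (F x) ^+ 2 <= rip (F x) x * rip (F (F x)) (F x).
  apply: (posform_cauchy_schwarz (B := fun x y => rip (F x) y)) => //.
  - by move=> a b c; rewrite (linfunD linF) ipDl // ReD.
  - by move=> r a c; rewrite (linfunZ linF) ipZl // Re_rM.
  - by move=> a b; rewrite saF rip_sym.
have := F1 x; have := F1 (F x); have := F0 x; have := F0 (F x).
move: cs; rewrite -!hnorm_sqr //.
have [->|Fx0] := eqVneq (N (F x)) 0; first by rewrite hnorm_ge0.
have Fx_gt0 : 0 < N (F x) ^+ 2 by rewrite exprn_even_gt0.
move=> cs h1 h2 h3 h4.
rewrite -(@ler_pXn2r _ 2) ?nnegrE ?hnorm_ge0 // -(ler_pM2r Fx_gt0) -expr2.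
apply: le_trans cs _; exact: ler_pM.
Qed.

(** For [B] above the norm of [F], the operator [Q = 1 - F / B] lies between 0 and 1 and is a
    contraction. With [Y] the fixed point for [Q], the operator [sqrt B (1 - Y)] squares to
    [B (1 - Q) = F], and it is positive since [Y] is a contraction. *)
Theorem positive_sqrt F (M : R) : linear F -> selfadjoint F ->
  (forall x, 0 <= rip (F x) x) -> (forall x, N (F x) <= M * N x) ->
  exists Z : V -> V,
  [/\ linear Z, selfadjoint Z, forall x, 0 <= rip (Z x) x,
      exists K : R, forall x, N (Z x) <= K * N x & forall x, Z (Z x) = F x].
Proof.
move=> linF saF F0 FM.
pose B := `|M| + 1.
have B0 : 0 < B by rewrite ltr_wpDl.
have FB x : N (F x) <= B * N x.
  apply: (le_trans (FM x)); apply: ler_wpM2r; first exact: hnorm_ge0.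
  by have := ler_norm M; rewrite /B; lra.
pose Q x := x - (B^-1)%:C *: F x.
have linQ : linear Q.
  move=> a x y; rewrite /Q linF scalerBr scalerDr opprD addrACA.
  by rewrite !scalerA (mulrC a).
have saQ : selfadjoint Q.
  by move=> x y; rewrite /Q ipBl // ipBr // ipZl // ipZr // conj_real saF.
have ripQ x : rip (Q x) x = rip x x - B^-1 * rip (F x) x.
  by rewrite /Q ipBl // ReD ReN ipZl // Re_rM.
have B10 : 0 < B^-1 by rewrite invr_gt0.
have Q1 : forall x, N (Q x) <= N x.
  apply: hnorm_le_of_form_le => // x; rewrite ripQ; last by have := F0 x; nra.
  rewrite subr_ge0 mulrC ler_pdivrMr // -hnorm_sqr // expr2 -mulrA mulrC.
  have := cauchy_schwarz ipP (F x) x; have := ler_norm (rip (F x) x).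
  have := FB x; have := hnorm_ge0 ip x; nra.
have [Y [linY saY Y1 YE]] := contraction_sqrt linQ saQ Q1.
pose r := Num.sqrt B; have rr : r * r = B by rewrite -expr2 sqr_sqrtr // ltW.
have r0 : 0 <= r by exact: sqrtr_ge0.
exists (fun x => r%:C *: (x - Y x)); split.
- move=> a x y; rewrite linY opprD addrACA -scalerBr scalerDr.
  by rewrite !scalerA (mulrC a).
- by move=> x y; rewrite ipZl // ipZr // conj_real ipBl // ipBr // saY.
- move=> x; rewrite ipZl // Re_rM mulr_ge0 // ipBl // ReD ReN subr_ge0.
  have := cauchy_schwarz ipP (Y x) x; have := ler_norm (rip (Y x) x).
  rewrite -hnorm_sqr //; have := Y1 x; have := hnorm_ge0 ip x; nra.
- exists (r * 2) => x; rewrite hnormZ // cabs_real ger0_norm // -mulrA.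
  apply: ler_wpM2l => //; have := le_hnormD ipP x (- Y x).
  rewrite hnorm_opp //; have := Y1 x; lra.
- move=> x.
  rewrite (linfunZ linY) -scalerBr scalerA -rmorphM rr (linfunB linY).
  have Y2 : Y (Y x) = Y x + Y x - Q x.
    have -> : Y x + Y x = 2%:C *: Y x by rewrite rmorph_nat scaler_nat mulr2n.
    rewrite [in RHS]YE scalerA -rmorphM divff ?pnatr_eq0 // scale1r.
    by rewrite addrAC subrr add0r.
  rewrite Y2 opprB [_ - Q x - _]addrAC addrK subrKA /Q opprB addrC subrK.
  by rewrite scalerA -rmorphM divff ?gt_eqF // scale1r.
Qed.

End SquareRoot.

(** * Square-summable sequences and uniqueness of the Moore-Penrose inverse *)

Section SquareSummable.
Variable R : realType.
Implicit Types (c d : seqC R) (n m k j : nat) (T X : seqC R -> seqC R).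
Local Open Scope complex_scope.

Lemma l2_psum_le c n : l2 c -> \sum_(k < n) cabs (c k) ^+ 2 <= l2normsq c.
Proof. by move=> [M cM]; apply: ub_le_sup; [exists M => _ [m ->] | exists n]. Qed.

Lemma l2normsq_le c (M : R) :
  (forall n, \sum_(k < n) cabs (c k) ^+ 2 <= M) -> l2normsq c <= M.
Proof.
move=> cM; apply: ge_sup => [|_ [n ->] //].
by exists (\sum_(k < 0) cabs (c k) ^+ 2); exists 0%N.
Qed.

Lemma l2normsq_ge0 c : l2 c -> 0 <= l2normsq c.
Proof. by move/(l2_psum_le 0); rewrite big_ord0. Qed.

Lemma l2norm_sqr c : l2 c -> l2norm c ^+ 2 = l2normsq c.
Proof. by move=> /l2normsq_ge0 c0; rewrite sqr_sqrtr. Qed.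

Lemma l2norm_ge0 c : 0 <= l2norm c.
Proof. exact: sqrtr_ge0. Qed.

Lemma l2norm0 : l2norm (0 : seqC R) = 0.
Proof.
apply/eqP; rewrite sqrtr_eq0; apply: l2normsq_le => n.
by rewrite big1 // => k _; rewrite (cabs_real 0) normr0 expr0n.
Qed.

Lemma l2norm_eq0 c : l2 c -> l2norm c = 0 -> c = (fun=> 0).
Proof.
move=> lc c0; apply/funext => j; apply/cabs_eq0/eqP; rewrite -sqrf_eq0.
have := l2_psum_le j.+1 lc; rewrite -l2norm_sqr // c0 expr0n /= big_ord_recr /=.
have : 0 <= \sum_(k < j) cabs (c k) ^+ 2 by apply: sumr_ge0 => k _; exact: sqr_ge0.
by have := sqr_ge0 (cabs (c j)); rewrite eq_le; lra.
Qed.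

Lemma psum_mono c n m : (n <= m)%N ->
  \sum_(k < n) cabs (c k) ^+ 2 <= \sum_(k < m) cabs (c k) ^+ 2.
Proof.
elim: m => [|m IH]; first by rewrite leqn0 => /eqP->.
rewrite leq_eqVlt => /orP[/eqP->//|/IH]; rewrite big_ord_recr /=.
have := sqr_ge0 (cabs (c m)); lra.
Qed.

Lemma l2_tail_small c (e : R) : l2 c -> 0 < e ->
  exists n0, forall n, (n0 <= n)%N ->
    l2normsq c - \sum_(k < n) cabs (c k) ^+ 2 < e.
Proof.
move=> [M cM] e0.
have hs : has_sup [set x | exists n : nat, x = \sum_(k < n) cabs (c k) ^+ 2]%classic.
  split; last by exists M => _ [m ->].
  by exists (\sum_(k < 0) cabs (c k) ^+ 2); exists 0%N.
have [_ [n0 ->]] := sup_adherent e0 hs; rewrite -/(l2normsq c) => lt.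
exists n0 => n /(psum_mono c); lra.
Qed.

Lemma l2ip_self c : l2 c -> l2ip c c = (l2normsq c)%:C.
Proof.
move=> lc; apply: clim_eq => e e0; have [n0 h] := l2_tail_small lc e0.
exists n0 => n /h lt.
under eq_bigr do rewrite -sqr_cabs_mulJ.
rewrite -rmorph_sum -rmorphB cabs_real distrC ger0_norm //.
by rewrite subr_ge0; exact: l2_psum_le.
Qed.

Lemma l2ip_delta c j : l2ip c (fun k => (k == j)%:R) = c j.
Proof.
apply: clim_eq => e e0; exists j.+1 => n jn.
rewrite (bigD1 (Ordinal jn)) //= eqxx conjc1 mulr1 big1 ?addr0.
  by rewrite subrr (cabs_real 0) normr0.
move=> i; rewrite -val_eqE /= => /negbTE->.
by rewrite conjc0 mulr0.
Qed.

Lemma l2_delta j : l2 (fun k => (k == j)%:R : R[i]).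
Proof.
exists 1 => n; have cb (b : bool) : cabs (b%:R : R[i]) ^+ 2 = b%:R.
  by case: b; rewrite sqr_cabs /= ?expr1n expr0n addr0 ?expr0n.
under eq_bigr do rewrite cb.
have [jn|nj] := ltnP j n.
  rewrite (bigD1 (Ordinal jn)) //= eqxx big1 ?addr0 // => i.
  by rewrite -val_eqE /= => /negbTE->.
rewrite big1 // => i _; rewrite (_ : (i == j :> nat) = false) //.
by apply/negbTE; rewrite neq_ltn (leq_trans (ltn_ord i) nj).
Qed.

Lemma l2ip_inj c c' : (forall d, l2 d -> l2ip c d = l2ip c' d) -> c = c'.
Proof.
move=> h; apply/funext => j; rewrite -(l2ip_delta c) -(l2ip_delta c').
exact/h/l2_delta.
Qed.

(** Taking adjoints in [TX = (TX')(TX)] gives [TX = (TX)(TX') = TX']; likewise [XT = X'T]. Then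
    [X = XTX = XTX' = X'TX' = X']. *)
Lemma pinv_unique T X X' : (forall c, l2 c -> l2 (T c)) ->
  is_pinv T X -> is_pinv T X' -> forall c, l2 c -> X c = X' c.
Proof.
move=> Tl2 [[Xl2 _ _] TXT XTX saTX saXT] [[X'l2 _ _] TX'T X'TX' saTX' saX'T].
have TXE c : l2 c -> T (X c) = T (X' c).
  move=> lc; apply: l2ip_inj => d ld.
  rewrite -(TX'T (X c)) ?(saTX', saTX); auto.
  by rewrite TXT; auto.
have XTE c : l2 c -> X (T c) = X' (T c).
  move=> lc; apply: l2ip_inj => d ld.
  have -> : X (T c) = X (T (X' (T c))) by rewrite TX'T.
  by rewrite saXT ?saX'T ?TXT; auto.
move=> c lc; rewrite -(XTX _ lc) TXE // XTE ?X'TX'; auto.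
Qed.

End SquareSummable.

(** * The closed span of a sequence *)

Section Span.
Variables (R : realType) (V : lmodType R[i]) (ip : V -> V -> R[i]).
Hypothesis ipP : inner_product ip.
Variable u : nat -> V.
Implicit Types (x y z : V) (c d a : seqC R).
Local Open Scope complex_scope.
Local Notation N := (hnorm ip).
Local Notation rip x y := (complex.Re (ip x y)).
Local Notation psum c n := (\sum_(k < n) c k *: u k).

(** Zero padding lets sums of different lengths be combined termwise. *)
Lemma psum_widen c n m : (n <= m)%N ->
  psum c n = psum (fun k => if (k < n)%N then c k else 0) m.
Proof.
move=> nm; rewrite (big_ord_widen m (fun k => c k *: u k) nm) big_mkcond /=.
by apply: eq_bigr => i _; case: ifP => // _; rewrite scale0r.
Qed.

Lemma psum_lin (a : R[i]) c d n :
  psum (fun k => a * c k + d k) n = a *: psum c n + psum d n.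
Proof.
rewrite scaler_sumr -big_split /=.
by apply: eq_bigr => i _; rewrite scalerDl scalerA.
Qed.

Lemma cspan_psum c n : cspan ip u (psum c n).
Proof. by move=> e e0; exists n, c; rewrite subrr hnorm0. Qed.

Lemma cspan0 : cspan ip u 0.
Proof. by have := cspan_psum (fun=> 0) 0; rewrite big_ord0. Qed.

Lemma cspan_gen j : cspan ip u (u j).
Proof.
have := cspan_psum (fun k => (k == j)%:R) j.+1.
rewrite big_ord_recr /= eqxx scale1r big1 ?add0r // => i _.
by rewrite (ltn_eqF (ltn_ord i)) scale0r.
Qed.

Lemma cspan_lin (a : R[i]) x y :
  cspan ip u x -> cspan ip u y -> cspan ip u (a *: x + y).
Proof.
move=> ux uy e e0; have a1 : 0 < 2 * (cabs a + 1) by have := cabs_ge0 a; lra.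
have e2 : 0 < e / 2 by rewrite divr_gt0.
have [n [c xc]] := ux _ (divr_gt0 e0 a1); have [m [d yd]] := uy _ e2.
exists (maxn n m), (fun k => a * (if (k < n)%N then c k else 0)
                             + if (k < m)%N then d k else 0).
rewrite (_ : \sum_(k < _) _ = a *: psum c n + psum d m); last first.
  rewrite (psum_widen c (leq_maxl n m)) (psum_widen d (leq_maxr n m)).
  exact: (psum_lin a (fun k => if (k < n)%N then c k else 0)
                     (fun k => if (k < m)%N then d k else 0)).
rewrite opprD addrACA -scalerBr; apply: le_lt_trans (le_hnormD ipP _ _) _.
rewrite hnormZ //; move: xc yd; rewrite ltr_pdivlMr //.
have := hnorm_ge0 ip (x - psum c n); have := cabs_ge0 a; nra.
Qed.

Lemma cspan_closed (s : nat -> V) x :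
  (forall n, cspan ip u (s n)) -> hconv ip s x -> cspan ip u x.
Proof.
move=> us sx e e0; have e2 : 0 < e / 2 by rewrite divr_gt0.
have [n0 /(_ _ (leqnn n0)) h] := sx _ e2.
have [n [c hc]] := us n0 _ e2; exists n, c.
have := hnorm_tri ipP (s n0) x (psum c n); rewrite (hnorm_distC ipP x (s _)); lra.
Qed.

(** * Synthesis and analysis operators of a frame sequence *)

Section Frame.
Hypothesis complete : forall s, hcauchy ip s -> exists x, hconv ip s x.
Variables A B : R.
Hypothesis A_gt0 : 0 < A.
Hypothesis B_gt0 : 0 < B.
Hypothesis frame : forall f, cspan ip u f -> l2 (analysis ip u f) /\
  A * hnorm ip f ^+ 2 <= l2normsq (analysis ip u f) <= B * hnorm ip f ^+ 2.
Local Notation U := (cspan ip u).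
Local Notation ana := (analysis ip u).
Local Notation syn := (synthesis ip u).
Local Notation P := (proj ip U).

(** The weight [B^-1] is chosen to cancel the upper frame bound once [b] runs over frame
    coefficients. *)
Lemma Re_mulJ_le (a b : R[i]) :
  complex.Re (a * conjc b) <= 2^-1 * (B * cabs a ^+ 2 + B^-1 * cabs b ^+ 2).
Proof.
rewrite !sqr_cabs; case: a b => [x y] [z t] /=.
have sq (p q : R) : 2 * (p * q) <= B * p ^+ 2 + B^-1 * q ^+ 2.
  have := mulr_ge0 (ltW B_gt0) (sqr_ge0 (p - B^-1 * q)).
  have -> : B * (p - B^-1 * q) ^+ 2 = B * p ^+ 2 + B^-1 * q ^+ 2 - 2 * (p * q).
    by field; rewrite gt_eqF.
  by rewrite subr_ge0.
have := sq x z; have := sq y t; lra.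
Qed.

(* AM-GM on [|s|^2 = Re (sum_k c_k conj <s, u_k>)], where the upper frame
   bound controls [sum_k |<s, u_k>|^2]; half of [|s|^2] is absorbed. *)
Lemma hnorm_psum_le c n : N (psum c n) ^+ 2 <= B * \sum_(k < n) cabs (c k) ^+ 2.
Proof.
set s := psum c n; have Us : U s by exact: cspan_psum.
have [ls /andP[_ leB]] := frame Us; have := l2_psum_le n ls.
have : N s ^+ 2 <=
    2^-1 * (B * \sum_(k < n) cabs (c k) ^+ 2
            + B^-1 * \sum_(k < n) cabs (ana s k) ^+ 2).
  rewrite hnorm_sqr // {1}/s (ip_suml ipP n (fun k => c k *: u k)).
  have -> : complex.Re (\sum_(k < n) ip (c k *: u k) s)
      = \sum_(k < n) complex.Re (c k * conjc (ana s k)).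
    rewrite (big_morph _ (@ReD R) (erefl : complex.Re 0 = 0)).
    by apply: eq_bigr => k _; rewrite ipZl // /analysis -ipC.
  rewrite !mulr_sumr -big_split /= mulr_sumr.
  by apply: ler_sum => k _; exact: Re_mulJ_le.
move=> le1 le2; have := le_trans le2 leB.
rewrite mulrC -ler_pdivrMr // mulrC; lra.
Qed.

Lemma psum_cauchy c : l2 c -> hcauchy ip (fun n => psum c n).
Proof.
move=> lc e e0.
have e2 : 0 < e / 2 by rewrite divr_gt0.
have d0 : 0 < (e / 2) ^+ 2 / B by rewrite divr_gt0 ?exprn_gt0.
have [n0 h] := l2_tail_small lc d0; exists n0.
have near n : (n0 <= n)%N -> N (psum c n - psum c n0) < e / 2.
  move=> ln; rewrite -(@ltr_pXn2r _ 2) ?nnegrE ?hnorm_ge0 ?(ltW e2) //.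
  have := h _ (leqnn n0); rewrite ltr_pdivlMr // mulrC; apply: le_lt_trans.
  (* A difference of partial sums is the partial sum of the truncated sequence [t], so its squared
     norm is at most [B] times a tail of [c]. *)
  pose t k := if (k < n0)%N then 0 else c k.
  have tE : psum c n - psum c n0 = psum t n.
    rewrite (psum_widen c ln) -sumrB; apply: eq_bigr => k _; rewrite /t.
    by case: ifP; rewrite ?subrr ?scale0r ?subr0.
  rewrite tE; apply: le_trans (hnorm_psum_le t n) _.
  rewrite ler_pM2l //.
  have -> : \sum_(k < n) cabs (t k) ^+ 2 =
      \sum_(k < n) cabs (c k) ^+ 2 - \sum_(k < n0) cabs (c k) ^+ 2.
    rewrite (big_ord_widen n (fun k => cabs (c k) ^+ 2) ln) [X in _ - X]big_mkcond /=.
    rewrite -sumrB; apply: eq_bigr => k _; rewrite /t.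
    by case: ifP; rewrite ?subrr ?subr0 // (cabs_real 0) normr0 expr0n.
  by rewrite lerB // l2_psum_le.
move=> n m /near hn /near hm.
have := hnorm_tri ipP (psum c n0) (psum c n) (psum c m).
rewrite (hnorm_distC ipP (psum c n0)); lra.
Qed.

Lemma synthesis_conv c : l2 c -> hconv ip (fun n => psum c n) (syn c).
Proof. by move=> /psum_cauchy/complete; exact: epsilon_spec. Qed.

Lemma synthesis_eq c x : hconv ip (fun n => psum c n) x -> syn c = x.
Proof.
by move=> cx; apply: (hconv_unique ipP _ cx); apply: epsilon_spec; exists x.
Qed.

Lemma synthesis_in c : l2 c -> U (syn c).
Proof.
by move=> /synthesis_conv; apply: cspan_closed => n; exact: cspan_psum.
Qed.

Lemma synthesis_lin (a : R[i]) c d : l2 c -> l2 d ->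
  syn (fun k => a * c k + d k) = a *: syn c + syn d.
Proof.
move=> lc ld; apply: synthesis_eq.
have := hconvD ipP (hconvZ ipP a (synthesis_conv lc)) (synthesis_conv ld).
by congr (hconv ip); apply/funext => n; rewrite psum_lin.
Qed.

Lemma hnorm_synthesis_le c : l2 c -> N (syn c) <= Num.sqrt B * l2norm c.
Proof.
move=> lc; apply: (hnorm_lim_le ipP (synthesis_conv lc)) => n.
rewrite -(@ler_pXn2r _ 2) ?nnegrE ?hnorm_ge0 ?mulr_ge0 ?sqrtr_ge0 //.
rewrite exprMn l2norm_sqr // (sqr_sqrtr (ltW B_gt0)).
apply: le_trans (hnorm_psum_le c n) _; rewrite ler_pM2l //; exact: l2_psum_le.
Qed.

Let P_in x : U (P x).
Proof. exact: (proj_in ipP complete cspan0 cspan_lin cspan_closed). Qed.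

Let P_id x : U x -> P x = x.
Proof. exact: (proj_id ipP complete cspan0 cspan_lin cspan_closed). Qed.

Let P_lin (a : R[i]) x y : P (a *: x + y) = a *: P x + P y.
Proof. exact: (proj_linear ipP complete cspan0 cspan_lin cspan_closed). Qed.

Let ip_Pl x y : U y -> ip (P x) y = ip x y.
Proof. exact: (ip_projl ipP complete cspan0 cspan_lin cspan_closed). Qed.

(** The generators lie in [U], so they see only the component of [x] there. This carries the upper
    frame bound, assumed on [U], to all of [V]. *)
Lemma analysis_proj x : ana (P x) = ana x.
Proof. by apply/funext => j; apply: ip_Pl; exact: cspan_gen. Qed.

Lemma analysis_l2 x : l2 (ana x).
Proof. by rewrite -analysis_proj; case: (frame (P_in x)). Qed.

Lemma l2norm_analysis_le x : l2norm (ana x) <= Num.sqrt B * N x.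
Proof.
rewrite -(@ler_pXn2r _ 2) ?nnegrE ?l2norm_ge0 ?mulr_ge0 ?sqrtr_ge0 ?hnorm_ge0 //.
rewrite exprMn (l2norm_sqr (analysis_l2 x)) (sqr_sqrtr (ltW B_gt0)).
rewrite -analysis_proj; have [_ /andP[_ /le_trans]] := frame (P_in x); apply.
rewrite ler_pM2l // ler_pXn2r ?nnegrE ?hnorm_ge0 //.
exact: (hnorm_proj_le ipP complete cspan0 cspan_lin cspan_closed).
Qed.

Lemma analysis_lin (a : R[i]) x y :
  ana (a *: x + y) = (fun k => a * ana x k + ana y k).
Proof. by apply/funext => j; rewrite /analysis ipDl // ipZl. Qed.

(** The partial sums of [l2ip] are inner products of [x] with partial sums of the synthesis series,
    so continuity of [ip] yields the limit. *)
Lemma l2ip_analysisl x d : l2 d -> l2ip (ana x) d = ip x (syn d).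
Proof.
move=> /synthesis_conv/(cconv_ipr ipP x) cv; apply: clim_eq.
move: cv; congr (cconv _ _); apply/funext => n.
rewrite (ipC ipP) (ip_suml ipP n (fun k => d k *: u k)) rmorph_sum /=.
apply: eq_bigr => k _.
by rewrite ipZl // rmorphM /= mulrC -(ipC ipP).
Qed.

Lemma l2ip_analysisr c x : l2 c -> l2ip c (ana x) = ip (syn c) x.
Proof.
move=> /synthesis_conv/(cconv_ipl ipP x) cv; apply: clim_eq.
move: cv; congr (cconv _ _); apply/funext => n.
rewrite (ip_suml ipP n (fun k => c k *: u k)); apply: eq_bigr => k _.
by rewrite ipZl // /analysis -(ipC ipP).
Qed.

(** * The frame operator and its inverse on the closed span *)

Definition frame_op x : V := syn (ana x).
Local Notation T0 := frame_op.

Lemma frame_op_linear : linear T0.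
Proof.
move=> a x y; rewrite /T0 analysis_lin synthesis_lin //; exact: analysis_l2.
Qed.

Lemma frame_op_selfadjoint : selfadjoint ip T0.
Proof.
move=> x y; rewrite -l2ip_analysisl ?l2ip_analysisr //; exact: analysis_l2.
Qed.

Lemma frame_op_in x : U (T0 x).
Proof. exact/synthesis_in/analysis_l2. Qed.

Lemma frame_op_proj x : T0 (P x) = T0 x.
Proof. by rewrite /T0 analysis_proj. Qed.

Lemma frame_op_le x : N (T0 x) <= B * N x.
Proof.
apply: le_trans (hnorm_synthesis_le (analysis_l2 x)) _.
rewrite -{2}(sqr_sqrtr (ltW B_gt0)) expr2 -mulrA.
by apply: ler_wpM2l (l2norm_analysis_le x); exact: sqrtr_ge0.
Qed.

Lemma frame_op_form x : rip (T0 x) x = l2normsq (ana x).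
Proof. by rewrite -l2ip_analysisr ?l2ip_self //; exact: analysis_l2. Qed.

Lemma frame_op_form_ge x : U x -> A * N x ^+ 2 <= rip (T0 x) x.
Proof. by rewrite frame_op_form => /frame[_ /andP[]]. Qed.

Lemma frame_op_norm_ge x : U x -> A * N x <= N (T0 x).
Proof.
move=> /frame_op_form_ge le; have := cauchy_schwarz ipP (T0 x) x.
have := ler_norm (rip (T0 x) x); have [->|x0] := eqVneq (N x) 0.
  by move=> *; rewrite mulr0 hnorm_ge0.
move=> le1 le2; have x_gt0 : 0 < N x by rewrite lt_neqAle eq_sym x0 hnorm_ge0.
rewrite -(ler_pM2r x_gt0) -mulrA -expr2.
exact: le_trans le (le_trans le1 le2).
Qed.

Lemma frame_op_inj x y : U x -> U y -> T0 x = T0 y -> x = y.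
Proof.
move=> Ux Uy E; apply/subr0_eq/(hnorm_eq0 ipP)/eqP; rewrite eq_le hnorm_ge0 andbT.
have Ud : U (x - y) by exact: (subspaceB cspan_lin).
have := frame_op_norm_ge Ud; rewrite (linfunB frame_op_linear) E subrr hnorm0 //.
by rewrite pmulr_rle0.
Qed.

(* [T0] is bounded below on [U], so its range is closed; a vector of [U]
   orthogonal to that range is killed by the form of [T0], hence zero. *)
Lemma frame_op_surj x : U x -> exists y, U y /\ T0 y = x.
Proof.
move=> Ux; pose Rg := [set z | exists2 y, U y & T0 y = z]%classic.
have Rg0 : Rg 0 by exists 0; [exact: cspan0 | exact: linfun0 frame_op_linear].
have Rg_lin (a : R[i]) y z : Rg y -> Rg z -> Rg (a *: y + z).
  move=> [y' Uy <-] [z' Uz <-]; exists (a *: y' + z'); first exact: cspan_lin.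
  exact: frame_op_linear.
have Rg_closed (s : nat -> V) z : (forall n, Rg (s n)) -> hconv ip s z -> Rg z.
  move=> Rs sz; have /choice[t tP] n : exists y, U y /\ T0 y = s n.
    by have [y Uy yE] := Rs n; exists y.
  have [|y ty] := complete (s := t).
    move=> e e0; have [n0 h] := hconv_cauchy ipP sz (mulr_gt0 A_gt0 e0).
    exists n0 => n m n0n n0m; rewrite -(ltr_pM2l A_gt0).
    apply: le_lt_trans (h _ _ n0n n0m).
    have [Un <-] := tP n; have [Um <-] := tP m.
    rewrite -(linfunB frame_op_linear); apply: frame_op_norm_ge.
    exact: (subspaceB cspan_lin).
  exists y; first by apply: cspan_closed ty => n; case: (tP n).
  apply: (hconv_unique ipP) sz.
  apply: (hconv_dominated (M := B)) ty => n.
  have [_ <-] := tP n; rewrite -(linfunB frame_op_linear); exact: frame_op_le.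
have [p [[y Uy yE] orth]] := exists_proj ipP complete Rg0 Rg_lin Rg_closed x.
exists y; split=> //; rewrite yE; apply/esym/subr0_eq/(hnorm_eq0 ipP).
have Uz : U (x - p).
  by apply: (subspaceB cspan_lin) => //; rewrite -yE; exact: frame_op_in.
have := orth (T0 (x - p)); rewrite -frame_op_selfadjoint => orth0.
have /orth0 z0 : Rg (T0 (x - p)) by exists (x - p).
have := frame_op_form_ge Uz; rewrite z0 /= pmulr_rle0 // => h.
by apply/eqP; rewrite -sqrf_eq0 eq_le h sqr_ge0.
Qed.

Lemma exists_frame_op_pinv : exists J : V -> V,
  [/\ linear J, selfadjoint ip J, forall x, 0 <= rip (J x) x,
      exists M : R, forall x, N (J x) <= M * N x
    & forall x, [/\ U (J x), T0 (J x) = P x & J (T0 x) = P x]].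
Proof.
have /choice[J JP] x := frame_op_surj (P_in x).
have JU x : U (J x) by case: (JP x).
have TJ x : T0 (J x) = P x by case: (JP x).
(* The lower frame bound at [J x], with [T0 (J x) = P x]; it yields both positivity of [J] and the
   norm bound [A^-1]. *)
have form x : A * N (J x) ^+ 2 <= rip (J x) x.
  apply: le_trans (frame_op_form_ge (JU x)) _.
  by rewrite TJ ip_Pl // rip_sym.
exists J; split=> //.
- move=> a x y; apply: frame_op_inj => //; first exact: cspan_lin.
  by rewrite frame_op_linear !TJ P_lin.
- move=> x y; rewrite [LHS](ipC ipP) -(ip_Pl y (JU x)) -TJ frame_op_selfadjoint TJ.
  by rewrite -(ipC ipP) ip_Pl.
- by move=> x; apply: le_trans (form x); rewrite mulr_ge0 ?sqr_ge0 // ltW.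
- exists A^-1 => x; rewrite mulrC ler_pdivlMr // mulrC.
  have := form x; have := cauchy_schwarz ipP (J x) x.
  have := ler_norm (rip (J x) x); have [->|x0] := eqVneq (N (J x)) 0.
    by move=> *; rewrite mulr0 hnorm_ge0.
  move=> le1 le2 le3.
  have x_gt0 : 0 < N (J x) by rewrite lt_neqAle eq_sym x0 hnorm_ge0.
  rewrite -(ler_pM2r x_gt0) -mulrA -expr2 [N x * _]mulrC.
  exact: le_trans le3 (le_trans le1 le2).
- move=> x; split=> //; apply: frame_op_inj => //.
  by rewrite TJ P_id ?frame_op_proj //; exact: frame_op_in.
Qed.

(** * Pseudoinverse of the Gram operator and its square root *)

Local Notation gram := (fun c : seqC R => ana (syn c)).

(** Composing the sandwiches of [L] and [L'] gives that of [L T0 L'], so identities between sequence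
    operators reduce to identities with [T0] on [V]. *)
Local Notation sandwich L := (fun c : seqC R => ana (L (syn c))).

Lemma sandwich_bounded (L : V -> V) (M : R) : linear L ->
  (forall x, N (L x) <= M * N x) -> l2_bounded_linear (sandwich L).
Proof.
move=> linL LM; split.
- by move=> c _; exact: analysis_l2.
- by move=> a c d lc ld; rewrite synthesis_lin // linL analysis_lin.
- exists (Num.sqrt B * (`|M| * Num.sqrt B)) => c lc.
  apply: le_trans (l2norm_analysis_le _) _; rewrite -!mulrA.
  apply: ler_wpM2l; first exact: sqrtr_ge0.
  apply: (le_trans (LM _)); apply: (@le_trans _ _ (`|M| * N (syn c))).
    by apply: ler_wpM2r (ler_norm M); exact: hnorm_ge0.
  by apply: ler_wpM2l (hnorm_synthesis_le lc).
Qed.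

Lemma sandwich_selfadjoint (L : V -> V) :
  selfadjoint ip L -> l2_selfadjoint (sandwich L).
Proof.
by move=> saL c d lc ld; rewrite l2ip_analysisl // l2ip_analysisr.
Qed.

(** Since [T0 J = J T0 = P], both [gram X] and [X gram] act on [l2] as the sandwich of [J]. The
    square of [S] is the sandwich of [Z J T0 J Z = Z J Z = J J]. *)
Lemma exists_pinv_sqrt : exists X S,
  is_pinv gram X /\ is_psqrt X S.
Proof.
have [J [linJ saJ J0 [M JM] JP]] := exists_frame_op_pinv.
have [Z [linZ saZ Z0 [K ZK] ZZ]] := positive_sqrt ipP complete linJ saJ J0 JM.
have JU x : U (J x) by case: (JP x).
have TJ x : T0 (J x) = P x by case: (JP x).
have JT x : J (T0 x) = P x by case: (JP x).
have JZ x : J (Z x) = Z (J x) by rewrite -!ZZ.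
have lin_comp (F G : V -> V) : linear F -> linear G -> linear (fun x => F (G x)).
  by move=> linF linG a x y; rewrite linG linF.
have bnd_comp F G (m k : R) : (forall x, N (F x) <= m * N x) ->
    (forall x, N (G x) <= k * N x) -> forall x, N (F (G x)) <= (`|m| * k) * N x.
  move=> Fm Gk x; apply: (le_trans (Fm _)).
  apply: (@le_trans _ _ (`|m| * N (G x))).
    by apply: ler_wpM2r (ler_norm m); exact: hnorm_ge0.
  by rewrite -mulrA; apply: ler_wpM2l.
exists (sandwich (fun x => J (J x))), (sandwich (fun x => J (Z x))); split; split.
- exact: (sandwich_bounded (lin_comp _ _ linJ linJ) (bnd_comp _ _ _ _ JM JM)).
- move=> c lc /=; rewrite -!/(T0 _) TJ P_id // JT analysis_proj //.
- move=> c lc /=; rewrite -!/(T0 _) TJ P_id // TJ P_id //; exact: synthesis_in.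
- rewrite (_ : (fun c => _) = sandwich J); first exact: (sandwich_selfadjoint saJ).
  by apply/funext => c /=; rewrite -/(T0 _) TJ P_id.
(* Unlike for [gram X], the simplification uses [syn e] in [U], which is available for [l2]
   sequences; hence no equality of functions here. *)
- move=> c d lc ld.
  have E e : l2 e -> ana (J (J (syn (ana (syn e))))) = ana (J (syn e)).
    by move=> le; rewrite -/(T0 _) JT P_id //; exact: synthesis_in.
  by rewrite !E //; exact: (sandwich_selfadjoint saJ).
- exact: (sandwich_bounded (lin_comp _ _ linJ linZ) (bnd_comp _ _ _ _ JM ZK)).
- by apply: (sandwich_selfadjoint (L := fun x => J (Z x))) => x y; rewrite saJ saZ JZ.
- move=> c lc /=; rewrite l2ip_analysisl //.
  (* As [J Z = Z^3], the form of [S] at [c] is [<Z w, w>]. The order on [R[i]] also asks for a zero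
     imaginary part, which self-adjointness of [Z] provides. *)
  rewrite JZ -ZZ saZ; set w := Z (syn c).
  rewrite lecE /= Z0 andbT.
  have : ip (Z w) w = conjc (ip (Z w) w) by rewrite -(ipC ipP) saZ.
  by case: (ip _ _) => p q /= [h]; apply/eqP; lra.
- by move=> c lc /=; rewrite -/(T0 _) JZ JT P_id // -JZ ZZ.
Qed.

Local Notation sqrt_pinv := (pos_sqrt (mp_pinv gram)).

Lemma mp_pinvP : is_pinv gram (mp_pinv gram).
Proof. by apply: epsilon_spec; have [X [S [XP _]]] := exists_pinv_sqrt; exists X. Qed.

(** The explicit square root belongs to the explicit pseudoinverse, which agrees on [l2] with the
    one chosen by [mp_pinv] by uniqueness. *)
Lemma sqrt_pinvP : is_psqrt (mp_pinv gram) sqrt_pinv.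
Proof.
apply: epsilon_spec; have [X [S [Xpinv [Sb Ssa Spos SS]]]] := exists_pinv_sqrt.
exists S; split=> // c lc; rewrite SS //.
by apply: (pinv_unique _ Xpinv mp_pinvP) => // d _; exact: analysis_l2.
Qed.

(* Writing [P x = syn d], the vector [ana x] equals [gram d], and
   [<X gram d, gram d> = <gram X gram d, d> = <gram d, d> = |syn d|^2]. *)
Lemma l2norm_sqrt_pinv_analysis x : l2norm (sqrt_pinv (ana x)) = N (P x).
Proof.
have [[Sl2 _ _] Ssa _ SS] := sqrt_pinvP; have [[Xl2 _ _] TXT _ _ _] := mp_pinvP.
have lx := analysis_l2 x.
have [y [Uy yE]] := frame_op_surj (P_in x).
pose d := ana y; have ld : l2 d by exact: analysis_l2.
have xE : ana x = ana (syn d) by rewrite -analysis_proj -yE.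
have : (l2normsq (sqrt_pinv (ana x)))%:C = ip (P x) (P x).
  rewrite -(l2ip_self (Sl2 _ lx)) -(Ssa _ _ (Sl2 _ lx) lx) (SS _ lx).
  rewrite {2}xE (l2ip_analysisr _ (Xl2 _ lx)) -(l2ip_analysisl _ ld).
  by rewrite xE TXT // l2ip_analysisl // -yE.
rewrite (ip_self ipP) => -[E].
by rewrite /l2norm E.
Qed.

Lemma l2_sqrt_pinv_analysis x : l2 (sqrt_pinv (ana x)).
Proof. by have [[Sl2 _ _] _ _ _] := sqrt_pinvP; exact/Sl2/analysis_l2. Qed.

Lemma sqrt_pinv_analysis_eq0 x : P x = 0 -> sqrt_pinv (ana x) = 0.
Proof.
move=> Px0; apply: l2norm_eq0; first exact: l2_sqrt_pinv_analysis.
by rewrite l2norm_sqrt_pinv_analysis Px0 hnorm0.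
Qed.

End Frame.

(** * The angle bound and comparison of condition numbers *)

Lemma cos_angle_le (G : set V) x :
  (forall s, hcauchy ip s -> exists x, hconv ip s x) ->
  (forall (a : R[i]) x, G x -> G (a *: x)) -> G x ->
  cos_angle ip G (cspan ip u) * N x <= N (proj ip (cspan ip u) x).
Proof.
move=> complete GZ Gx; have [->|x0] := eqVneq (N x) 0.
  by rewrite mulr0 hnorm_ge0.
have x_gt0 : 0 < N x by rewrite lt_neqAle eq_sym x0 hnorm_ge0.
rewrite -ler_pdivlMr //; apply: ge_inf.
  by exists 0 => _ [y [_ _ ->]]; exact: hnorm_ge0.
have nZ (y : V) : N ((N x)^-1%:C *: y) = N y / N x.
  by rewrite hnormZ // cabs_real ger0_norm ?invr_ge0 ?hnorm_ge0 // mulrC.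
exists ((N x)^-1%:C *: x); split; first exact: GZ.
  by rewrite nZ divff.
have linP : linear (proj ip (cspan ip u)).
  move=> a y z; apply: (proj_linear ipP complete).
  - exact: cspan0.
  - exact: cspan_lin.
  - exact: cspan_closed.
by rewrite (linfunZ linP) nZ.
Qed.

End Span.

(* When [inf F = 0] also [inf G = 0] and both quotients take the junk value
   [x / 0 = 0]; a set without a supremum has the junk supremum [0]. *)
Lemma sup_div_inf_compare (R : realType) (T : Type) (K : set T)
    (F G : T -> R) (q : R) :
  0 < q -> (forall c, K c -> 0 <= F c) ->
  (forall c, K c -> q * F c <= G c <= F c) ->
  let ratio H := sup [set r | exists c, K c /\ r = H c]%classic /
                 inf [set r | exists c, K c /\ r = H c]%classic in
  q * ratio F <= ratio G <= ratio F / q.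
Proof.
move=> q0 F0 FG /=.
set SF := [set r | exists c, K c /\ r = F c]%classic.
set SG := [set r | exists c, K c /\ r = G c]%classic.
have [[c0 Kc0]|K0] := pselect (exists c, K c); last first.
  have -> : SF = set0 by apply/seteqP; split => // r [c [Kc _]]; apply: K0; exists c.
  have -> : SG = set0 by apply/seteqP; split => // r [c [Kc _]]; apply: K0; exists c.
  by rewrite sup0 !mul0r mulr0 lexx.
have G0 c : K c -> 0 <= G c.
  by move=> Kc; have := F0 _ Kc; have /andP[] := FG _ Kc; nra.
have neF : nonempty SF by exists (F c0), c0.
have neG : nonempty SG by exists (G c0), c0.
have lbF : has_lbound SF by exists 0 => _ [c [Kc ->]]; exact: F0.
have lbG : has_lbound SG by exists 0 => _ [c [Kc ->]]; exact: G0.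
have infG_le : inf SG <= inf SF.
  apply: lb_le_inf => // _ [c [Kc ->]]; have /andP[_] := FG _ Kc.
  by apply: le_trans; apply: (ge_inf lbG); exists c.
have infG_ge : q * inf SF <= inf SG.
  apply: lb_le_inf => // _ [c [Kc ->]]; have /andP[+ _] := FG _ Kc.
  apply: le_trans; rewrite ler_pM2l //; apply: (ge_inf lbF); by exists c.
have infF_ge0 : 0 <= inf SF by apply: lb_le_inf => // _ [c [Kc ->]]; exact: F0.
have [ubF|nubF] := pselect (has_ubound SF); last first.
  have nubG : ~ has_ubound SG.
    move=> [M ubM]; apply: nubF; exists (M / q) => _ [c [Kc ->]].
    rewrite ler_pdivlMr // mulrC; have /andP[+ _] := FG _ Kc; move=> /le_trans; apply.
    by apply: ubM; exists c.
  rewrite (@sup_out _ SF) ?(@sup_out _ SG); try by case.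
  by rewrite !mul0r mulr0 lexx.
have ubG : has_ubound SG.
  have [M ubM] := ubF; exists M => _ [c [Kc ->]].
  have /andP[_ +] := FG _ Kc; move=> /le_trans; apply; by apply: ubM; exists c.
have supG_le : sup SG <= sup SF.
  apply: ge_sup => // _ [c [Kc ->]]; have /andP[_ +] := FG _ Kc; move=> /le_trans; apply.
  by apply: (ub_le_sup ubF); exists c.
have supG_ge : q * sup SF <= sup SG.
  rewrite mulrC -ler_pdivlMr //; apply: ge_sup => // _ [c [Kc ->]].
  rewrite ler_pdivlMr // mulrC; have /andP[+ _] := FG _ Kc; move=> /le_trans; apply.
  by apply: (ub_le_sup ubG); exists c.
have supF_ge0 : 0 <= sup SF.
  by apply: le_trans (F0 _ Kc0) _; apply: (ub_le_sup ubF); exists c0.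
have [iF0|iF0] := eqVneq (inf SF) 0.
  have -> : inf SG = 0.
    by apply/eqP; rewrite eq_le; move: infG_le infG_ge; rewrite iF0 mulr0 => -> ->.
  by rewrite iF0 invr0 !mulr0 mul0r lexx.
have iF_gt0 : 0 < inf SF by rewrite lt_neqAle eq_sym iF0.
have iG_gt0 : 0 < inf SG by apply: lt_le_trans infG_ge; rewrite mulr_gt0.
(* The lower bound pairs [q sup F <= sup G] with [inf G <= inf F]; the upper one pairs
   [sup G <= sup F] with [q inf F <= inf G]. *)
apply/andP; split.
  rewrite ler_pdivlMr // mulrA mulrAC ler_pdivrMr //.
  apply: ler_pM => //; [by rewrite mulr_ge0 // ltW | exact: ltW].
rewrite -mulrA -invfM ler_pdivlMr ?mulr_gt0 // mulrAC ler_pdivrMr //.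
rewrite [inf SF * q]mulrC.
apply: ler_pM => //; last by rewrite mulr_ge0 // ltW.
by apply: le_trans supG_ge; rewrite mulr_ge0 // ltW.
Qed.

Theorem theorem7p3 (R : realType) (V : lmodType R[i]) (ip : V -> V -> R[i])
  (u g : nat -> V) :
  separable_hilbert_space ip ->
  frame_sequence ip u -> frame_sequence ip g ->
  let U := cspan ip u in
  let G := cspan ip g in
  let cphi := cos_angle ip G U in
  let SynU := synthesis ip u in
  let SynG := synthesis ip g in
  let AnaU := analysis ip u in
  let S := pos_sqrt (mp_pinv (fun c => AnaU (SynU c))) in
  0 < cphi ->
  (forall c : seqC R, l2 c ->
     cphi * hnorm ip (SynG c) <= l2norm (S (AnaU (SynG c))) <= hnorm ip (SynG c)) /\
  (cphi * kappa (hnorm ip) SynG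
     <= kappa (@l2norm R) (fun c => S (AnaU (SynG c)))
     <= kappa (hnorm ip) SynG / cphi).
Proof.
move=> [ipP complete _] [A [B [A0 B0 fu]]] [A' [B' [A'0 B'0 fg]]] U G cphi.
move=> SynU SynG AnaU S cphi0.
have normS x : l2norm (S (AnaU x)) = hnorm ip (proj ip U x).
  exact: (l2norm_sqrt_pinv_analysis ipP complete A0 B0 fu).
have bounds c : l2 c ->
    cphi * hnorm ip (SynG c) <= l2norm (S (AnaU (SynG c))) <= hnorm ip (SynG c).
  move=> lc; rewrite normS; apply/andP; split.
    apply: (@cos_angle_le _ _ _ ipP u G _ complete).
      move=> a x Gx; rewrite -[_ *: _]addr0.
      by apply: (cspan_lin ipP) => //; exact: cspan0.
    exact: (synthesis_in ipP complete B'0 fg).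
  apply: (hnorm_proj_le ipP complete).
  - exact: cspan0.
  - exact: cspan_lin.
  - exact: cspan_closed.
split=> //.
(* From left to right this is the lower bound with [cphi] positive; the converse uses that
   [P_U 0 = 0] makes the norm of [S (AnaU 0)] vanish. *)
have same_kernel d : l2 d -> (S (AnaU (SynG d)) = 0) <-> (SynG d = 0).
  move=> ld; split=> [S0|G0].
    apply: (hnorm_eq0 ipP); apply/eqP; rewrite eq_le hnorm_ge0 andbT.
    have /andP[+ _] := bounds d ld.
    by rewrite S0 l2norm0 pmulr_rle0.
  apply: (sqrt_pinv_analysis_eq0 ipP complete A0 B0 fu).
  rewrite G0; apply: (proj_id ipP complete).
  - exact: cspan0.
  - exact: cspan_lin.
  - exact: cspan_closed.
  - exact: cspan0.
(* Equal kernels have equal orthogonal complements, so both condition numbers range over the same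
   unit vectors and the pointwise bounds apply. *)
have sameK : [set c : seqC R | [/\ l2 c, l2norm c = 1 &
      forall d, l2 d -> S (AnaU (SynG d)) = 0 -> l2ip c d = 0]]%classic =
    [set c | [/\ l2 c, l2norm c = 1 &
      forall d, l2 d -> SynG d = 0 -> l2ip c d = 0]]%classic.
  by apply/seteqP; split=> c [lc c1 h]; split=> // d ld /(same_kernel _ ld); exact: h.
rewrite /kappa sameK; apply: sup_div_inf_compare => //.
  by move=> c _; exact: hnorm_ge0.
by move=> c [lc _ _]; exact: bounds.
Qed.
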